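(* Let $K$ be a field, $a,b\in\mathbb{Z}_{\ge0}$, $\ell=a+b$, let $X=\{x_0,\dots,x_\ell\}$ be a set of $\ell+1$ distinct points of $K$, and let $y_0,\dots,y_\ell\in K$. Let $d$ be maximal such that $0\le d\le a$ and $$A_0:=\sum_{X'\subset X,\ |X'|=d}R(x,X')\,\frac{\prod_{x_j\notin X'}y_j}{R(X\setminus X',X')}\ \in K[x]$$ is not identically zero (assuming that such a $d$ exists). For this $d$ set $$B_0:=\sum_{X''\subset X,\ |X''|=\ell-d}R(X'',x)\,\frac{\prod_{x_j\in X''}y_j}{R(X'',X\setminus X'')}\ \in K[x].$$ Then $\deg(B_0)\le b$, and a solution $\dfrac{A}{B}$ of the Cauchy interpolation problem for these data exists if and only if $B_0(x_i)\ne 0$ for all $0\le i\le\ell$. In that case the solution is given by $$\frac{A}{B}=\frac{A_0}{B_0}.$$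
   Context: **Cauchy interpolation problem.** Given the data, find polynomials $A,B\in K[x]$ with $\deg A\le a$, $\deg B\le b$, $B(x_i)\ne0$ and $\dfrac{A}{B}(x_i)=y_i$ for $0\le i\le\ell$. Such a pair (or the quotient $A/B$) is called a solution. The zero polynomial satisfies every degree bound. **Notation.** For finite sets $U,V$, $R(U,V):=\prod_{u\in U,\,v\in V}(u-v)$, an empty product being $1$. With $x$ the variable, $R(x,V):=\prod_{v\in V}(x-v)$ and $R(U,x):=\prod_{u\in U}(u-x)$. The product $\prod_{x_j\notin X'}y_j$ runs over indices $j\in\{0,\dots,\ell\}$ with $x_j\notin X'$. Equality of quotients is equality of rational functions. *)

(* Defs.v *)
From HB Require Import structures.
From mathcomp Require Import all_boot all_order all_algebra.
From mathcomp Require Import finmap.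

Set Implicit Arguments.
Unset Strict Implicit.
Unset Printing Implicit Defensive.

Import GRing.Theory.
Local Open Scope ring_scope.
Local Open Scope fset_scope.

Section DifferenceProducts.

Variable K : fieldType.
Implicit Types U V : {fset K}.

(* R(U, V), R(x, V) and R(U, x), with 'X for the variable x. *)
Definition diffprod U V : K := \prod_(u <- U) \prod_(v <- V) (u - v).

Definition diffprodXl V : {poly K} := \prod_(v <- V) ('X - v%:P).

Definition diffprodXr U : {poly K} := \prod_(u <- U) (u%:P - 'X).

End DifferenceProducts.

Section CauchyInterpolation.

Variables (K : fieldType) (l : nat).
Implicit Types x y : 'I_l.+1 -> K.

Definition nodes x : {fset K} := [fset x i | i in 'I_l.+1].

Definition sylvesterA x y (d : nat) : {poly K} :=
  \sum_(X' <- fpowerset (nodes x) | #|` X'| == d)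
     ((\prod_(j < l.+1 | x j \notin X') y j) / diffprod (nodes x `\` X') X')
       *: diffprodXl X'.

Definition sylvesterB x y (d : nat) : {poly K} :=
  \sum_(X'' <- fpowerset (nodes x) | #|` X''| == (l - d)%N)
     ((\prod_(j < l.+1 | x j \in X'') y j) / diffprod X'' (nodes x `\` X''))
       *: diffprodXr X''.

(* As size p = deg p + 1 for p != 0 and size 0 = 0, size p <= n.+1 says
   deg p <= n, the zero polynomial satisfying every degree bound. *)
Definition cauchy_solution (a b : nat) x y (A B : {poly K}) : Prop :=
  [/\ (size A <= a.+1)%N,
      (size B <= b.+1)%N,
      forall i, B.[x i] != 0
    & forall i, A.[x i] / B.[x i] = y i].

End CauchyInterpolation.

(* Main.v *)
(* Sylvester's pairs (A_d, B_d) satisfy A_d(x_i) = y_i B_d(x_i), and both values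
   are governed by the scalars sigma_k(X), the sums over the k-subsets of X of
   the weights in A_k.  The key fact is that sigma_k(X) vanishes iff some nonzero
   pair (P, Q) with deg P < k and deg Q < |X| - k satisfies P = y Q on X.  It is
   proved by removing a node x_i: up to a nonzero factor, sigma_(k+1)(X) is the
   defect at x_i of the interpolation condition for the pair
   (A_k, B_k) of X minus x_i.  The rest is the observation that
   two interpolating pairs of small degrees are proportional. *)
Require Import Defs.
From HB Require Import structures.
From mathcomp Require Import all_boot all_order all_algebra.
From mathcomp Require Import finmap.
From mathcomp Require Import ring zify.

Set Implicit Arguments.
Unset Strict Implicit.
Unset Printing Implicit Defensive.

Import GRing.Theory.
Local Open Scope ring_scope.

(** * Sums over subsets and products of linear factors *)

Lemma sum_subsets_split (V : nmodType) (I : finType) (X : {set I}) (i : I)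
    (k : nat) (F : {set I} -> V) : i \in X ->
  \sum_(S : {set I} | (S \subset X) && (#|S| == k)) F S =
  \sum_(S : {set I} | (S \subset X :\ i) && (#|S|.+1 == k)) F (i |: S) +
  \sum_(S : {set I} | (S \subset X :\ i) && (#|S| == k)) F S.
Proof.
move=> iX; rewrite (bigID (fun S : {set I} => i \in S)) /=; congr (_ + _).
  rewrite (reindex_onto (fun S => i |: S) (fun S => S :\ i)) /=; last first.
    by move=> S /andP[_ iS]; rewrite setD1K.
  apply: eq_bigl => S; rewrite setU11 andbT subUset sub1set iX /=.
  rewrite subsetD1; case: (boolP (i \in S)) => iS.
    rewrite andbF /= [_ == S]negbTE ?andbF //.
    by apply: contraTneq iS => <-; rewrite !inE eqxx.
  by rewrite andbT cardsU1 iS setU1K // eqxx andbT.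
by apply: eq_bigl => S; rewrite subsetD1 andbAC.
Qed.

Lemma size_prod_XsubC_set (R : idomainType) (I : finType) (f : I -> R)
    (S : {set I}) : size (\prod_(i in S) ('X - (f i)%:P)) = #|S|.+1.
Proof. by rewrite -big_enum /= size_prod_XsubC cardE. Qed.

Lemma prod_CsubX (R : comNzRingType) (I : finType) (f : I -> R)
    (S : {set I}) :
  \prod_(i in S) ((f i)%:P - 'X) =
  (-1) ^+ #|S| *: \prod_(i in S) ('X - (f i)%:P).
Proof.
rewrite (eq_bigr (fun i => - ('X - (f i)%:P))) => [|i _]; last by rewrite opprB.
by rewrite prodrN -mul_polyC rmorphXn rmorphN1.
Qed.

Lemma horner_prod_XsubC (R : comNzRingType) (I : finType) (f : I -> R)
    (S : {set I}) (c : R) :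
  (\prod_(i in S) ('X - (f i)%:P)).[c] = \prod_(i in S) (c - f i).
Proof. by rewrite horner_prod; under eq_bigr do rewrite hornerXsubC. Qed.

Lemma horner_prod_CsubX (R : comNzRingType) (I : finType) (f : I -> R)
    (S : {set I}) (c : R) :
  (\prod_(i in S) ((f i)%:P - 'X)).[c] = \prod_(i in S) (f i - c).
Proof. by rewrite horner_prod; under eq_bigr do rewrite !hornerE. Qed.

(** * Sylvester's sums over index sets and their values at the nodes *)

Section SylvesterSums.

Variables (K : fieldType) (I : finType) (x y : I -> K).
Hypothesis x_inj : injective x.
Implicit Types (X S : {set I}) (A B P Q : {poly K}) (i j : I) (d k n : nat).

(** Linearized condition: Q may vanish at nodes, so pairs can be combined linearly. *)
Definition interpolates X P Q := forall i, i \in X -> P.[x i] = y i * Q.[x i].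

Definition sylv_weight X S : K :=
  (\prod_(i in X :\: S) y i) /
  \prod_(i in X :\: S) \prod_(j in S) (x i - x j).

(** The scalar sigma_k(X). *)
Definition sylv_coef X k : K :=
  \sum_(S : {set I} | (S \subset X) && (#|S| == k)) sylv_weight X S.

Definition sylvA X d : {poly K} :=
  \sum_(S : {set I} | (S \subset X) && (#|S| == d))
    sylv_weight X S *: \prod_(j in S) ('X - (x j)%:P).

(* Indexed by the complement S of the set X'' of the paper, so that both sums
   share their weights. *)
Definition sylvB X d : {poly K} :=
  \sum_(S : {set I} | (S \subset X) && (#|S| == d.+1))
    sylv_weight X S *: \prod_(i in X :\: S) ((x i)%:P - 'X).

Lemma prod_diff_neq0 X S (i : I) : i \notin S -> \prod_(j in S) (x i - x j) != 0.
Proof.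
move=> iS; apply/prodf_neq0 => j jS; rewrite subr_eq0 (inj_eq x_inj).
by apply: contraNneq iS => ->.
Qed.

Lemma sylv_weightU1 X S i : i \in X -> S \subset X :\ i ->
  sylv_weight X (i |: S) =
  sylv_weight (X :\ i) S / \prod_(j in (X :\ i) :\: S) (x j - x i).
Proof.
move=> iX; rewrite subsetD1 => /andP[SX iS].
rewrite /sylv_weight -setDDl -mulrA -invfM -big_split /=; congr (_ / _).
by apply: eq_bigr => u _; rewrite mulrC big_setU1.
Qed.

Lemma setD_setD1 X S i : i \in X -> i \notin S ->
  X :\: S = i |: ((X :\ i) :\: S).
Proof.
move=> iX iS; apply/setP => j; rewrite !inE.
by case: eqP => [->|] /=; rewrite ?iX ?iS.
Qed.

Lemma sylv_weightD1 X S i : i \in X -> S \subset X :\ i ->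
  sylv_weight X S =
  sylv_weight (X :\ i) S * y i / \prod_(j in S) (x i - x j).
Proof.
move=> iX; rewrite subsetD1 => /andP[SX iS].
rewrite /sylv_weight (setD_setD1 iX iS) !big_setU1 ?inE ?eqxx ?andbF //=.
by rewrite invfM; ring.
Qed.

(** If i is in S, the product vanishes at x_i; otherwise its value cancels the factors that i
    contributes to the denominator of the weight. *)
Lemma sylvA_node X d i : i \in X ->
  (sylvA X d).[x i] = y i * sylv_coef (X :\ i) d.
Proof.
move=> iX; rewrite /sylvA (sum_subsets_split _ _ iX) hornerD !horner_sum.
rewrite big1 ?add0r => [|S]; last first.
  rewrite subsetD1 => /andP[/andP[SX iS] _].
  by rewrite big_setU1 //= hornerZ hornerM hornerXsubC subrr mul0r mulr0.
rewrite mulr_sumr; apply: eq_bigr => S /andP[SXi _].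
have iS : i \notin S by move: SXi; rewrite subsetD1 => /andP[].
rewrite (sylv_weightD1 iX SXi) hornerZ horner_prod_XsubC.
by rewrite divfK ?prod_diff_neq0 // mulrC.
Qed.

(** Here the subsets containing i survive. Removing i from them turns size [d.+1] into d, so the
    same sigma_d appears as for [sylvA]. *)
Lemma sylvB_node X d i : i \in X ->
  (sylvB X d).[x i] = sylv_coef (X :\ i) d.
Proof.
move=> iX; rewrite /sylvB (sum_subsets_split _ _ iX) hornerD !horner_sum.
rewrite [X in _ + X]big1 ?addr0 => [|S]; last first.
  rewrite subsetD1 => /andP[/andP[SX iS] _].
  rewrite (setD_setD1 iX iS) big_setU1 ?inE ?eqxx ?andbF //=.
  by rewrite hornerZ hornerM hornerD hornerN hornerC hornerX subrr mul0r mulr0.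
rewrite /sylv_coef; apply: eq_big => [S|S /andP[SXi _]]; first by rewrite eqSS.
rewrite (sylv_weightU1 iX SXi) -setDDl hornerZ horner_prod_CsubX.
rewrite divfK //; apply/prodf_neq0 => j; rewrite !inE => /and3P[_ ji _].
by rewrite subr_eq0 (inj_eq x_inj).
Qed.

Lemma sylv_interpolates X d : interpolates X (sylvA X d) (sylvB X d).
Proof. by move=> i iX; rewrite sylvA_node ?sylvB_node. Qed.

(** Subsets containing i give the [sylvA] term, the others the [sylvB] term. The signs come from
    turning x_j - x_i into x_i - x_j for j in S. *)
Lemma sylv_coef_recl X k i : i \in X ->
  sylv_coef X k.+1 * \prod_(j in X :\ i) (x j - x i) =
  (-1) ^+ k * ((sylvA (X :\ i) k).[x i] - y i * (sylvB (X :\ i) k).[x i]).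
Proof.
move=> iX; rewrite /sylv_coef (sum_subsets_split _ _ iX) mulrDl mulrBr.
have nz (S : {set I}) : S \subset X :\ i -> \prod_(j in S) (x j - x i) != 0.
  move=> SX; apply/prodf_neq0 => j /(subsetP SX); rewrite !inE => /andP[ji _].
  by rewrite subr_eq0 (inj_eq x_inj).
have prodN (S : {set I}) : \prod_(j in S) (x j - x i) =
    (-1) ^+ #|S| * \prod_(j in S) (x i - x j).
  by rewrite -prodrN; apply: eq_bigr => j _; rewrite opprB.
have split (S : {set I}) : S \subset X :\ i -> \prod_(j in X :\ i) (x j - x i) =
    \prod_(j in S) (x j - x i) * \prod_(j in (X :\ i) :\: S) (x j - x i).
  by move=> /setIidPr SX; rewrite (big_setID S) /= SX.
congr (_ + _).
  rewrite mulr_suml horner_sum mulr_sumr.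
  apply: eq_big => [S|S /andP[SX /eqP Sk]]; first by rewrite eqSS.
  rewrite (sylv_weightU1 iX SX) (split _ SX) hornerZ horner_prod_XsubC.
  rewrite mulrCA divfK ?nz ?subsetDl // prodN; case: Sk => ->.
  by ring.
rewrite mulr_suml horner_sum !mulr_sumr -sumrN.
apply: eq_bigr => S /andP[SX /eqP Sk].
have iS : i \notin S by move: SX; rewrite subsetD1 => /andP[].
rewrite (sylv_weightD1 iX SX) (split _ SX) hornerZ horner_prod_CsubX.
rewrite prodN Sk exprS.
set p := \prod_(j in S) _; set q := \prod_(j in _ :\: _) _.
have p0 : p != 0 by apply: prod_diff_neq0.
by field.
Qed.

(** * Degrees and leading coefficients *)

Lemma size_sylvA X d : (size (sylvA X d) <= d.+1)%N.
Proof.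
apply: (leq_trans (size_sum _ _ _)); apply/bigmax_leqP => S /andP[_ /eqP <-].
by rewrite (leq_trans (size_scale_leq _ _)) // size_prod_XsubC_set.
Qed.

Lemma size_sylvB X d : (size (sylvB X d) <= (#|X| - d))%N.
Proof.
apply: (leq_trans (size_sum _ _ _)); apply/bigmax_leqP => S /andP[SX /eqP Sd].
rewrite (leq_trans (size_scale_leq _ _)) // prod_CsubX.
rewrite (leq_trans (size_scale_leq _ _)) // size_prod_XsubC_set cardsD.
by move: (subset_leq_card SX); rewrite (setIidPr SX) Sd; lia.
Qed.

Lemma coef_prod_XsubC_top S : (\prod_(j in S) ('X - (x j)%:P))`_#|S| = 1.
Proof.
have /monicP : \prod_(j in S) ('X - (x j)%:P) \is monic.
  by apply: monic_prod => j _; apply: monicXsubC.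
by rewrite lead_coefE size_prod_XsubC_set.
Qed.

Lemma coef_sylvA X d : (sylvA X d)`_d = sylv_coef X d.
Proof.
rewrite coef_sum; apply: eq_bigr => S /andP[_ /eqP <-].
by rewrite coefZ coef_prod_XsubC_top mulr1.
Qed.

Lemma coef_sylvB X d :
  (sylvB X d)`_(#|X| - d.+1) = (-1) ^+ (#|X| - d.+1) * sylv_coef X d.+1.
Proof.
rewrite coef_sum mulr_sumr; apply: eq_bigr => S /andP[SX /eqP Sd].
have <- : #|X :\: S| = (#|X| - d.+1)%N by rewrite cardsD (setIidPr SX) Sd.
by rewrite prod_CsubX !coefZ coef_prod_XsubC_top mulr1 mulrC.
Qed.

(** * Proportionality of interpolating pairs and vanishing of sigma_k *)

Lemma poly_eq0_nodes X P : (size P <= #|X|)%N ->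
  (forall i, i \in X -> P.[x i] = 0) -> P = 0.
Proof.
move=> sP P0; apply: (@roots_geq_poly_eq0 _ P (map x (enum X))).
- by apply/allP => _ /mapP[i iX ->]; rewrite mem_enum in iX; rewrite /root P0.
- by rewrite map_inj_uniq ?enum_uniq.
- by rewrite size_map -cardE.
Qed.

(** On X both products equal y Q B, and their difference has degree below |X|. *)
Lemma interpolates_cross X P Q A B :
  interpolates X P Q -> interpolates X A B ->
  (size (P * B)%R <= #|X|)%N -> (size (A * Q)%R <= #|X|)%N -> P * B = A * Q.
Proof.
move=> PQ AB s1 s2; apply/eqP; rewrite -subr_eq0; apply/eqP.
apply: (@poly_eq0_nodes X) => [|i iX].
  by rewrite (leq_trans (size_polyD _ _)) // size_polyN geq_max s1.
by rewrite !hornerE PQ // AB //; ring.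
Qed.

Lemma interpolates_sub X X' P Q :
  X' \subset X -> interpolates X P Q -> interpolates X' P Q.
Proof. by move=> /subsetP XX PQ i /XX; apply: PQ. Qed.

(** For k = m + 1, remove a node x_i with Q(x_i) nonzero. The degrees force (A_m, B_m) of the
    remaining nodes to be proportional to (P, Q), so its defect at x_i is zero. *)
Lemma sylv_coef_eq0 X k P Q : P != 0 -> interpolates X P Q ->
  (size P <= k)%N -> (size Q <= #|X| - k)%N -> sylv_coef X k = 0.
Proof.
move=> P0 PQ sP sQ.
case: k => [|k] in sP sQ *.
  by rewrite leqn0 size_poly_eq0 (negbTE P0) in sP.
have [kX|kX] := ltnP k #|X|; last first.
  rewrite /sylv_coef big_pred0 // => S; apply/negbTE/negP.
  by move=> /andP[/subset_leq_card SX /eqP Sk]; lia.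
(* Otherwise P would vanish on all of X, although its degree is below |X|. *)
have [i iX Qi0] : exists2 i, i \in X & Q.[x i] != 0.
  apply/exists_inP; apply: contraT => /exists_inPn Q0.
  have Qx0 i : i \in X -> Q.[x i] = 0 by move=> /Q0; rewrite negbK => /eqP.
  rewrite -(negbTE P0); apply/eqP.
  apply: (@poly_eq0_nodes X) => [|i iX]; first by lia.
  by rewrite PQ // Qx0 ?mulr0.
have cX : #|X| = #|X :\ i|.+1 by rewrite (cardsD1 i X) iX.
have cross : P * sylvB (X :\ i) k = sylvA (X :\ i) k * Q.
  have := size_polyMleq P (sylvB (X :\ i) k).
  have := size_polyMleq (sylvA (X :\ i) k) Q.
  have := size_sylvA (X :\ i) k; have := size_sylvB (X :\ i) k => s1 s2 s3 s4.
  apply: (@interpolates_cross (X :\ i)).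
  - exact: interpolates_sub (subsetDl _ _) PQ.
  - exact: sylv_interpolates.
  - by lia.
  - by lia.
have := sylv_coef_recl k iX.
have -> : (sylvA (X :\ i) k).[x i] = y i * (sylvB (X :\ i) k).[x i].
  by apply: (mulIf Qi0); rewrite -hornerM -cross hornerM PQ //; ring.
rewrite subrr mulr0 => /eqP; rewrite mulf_eq0 => /orP[/eqP //|].
move/prodf_eq0 => [j]; rewrite !inE => /andP[ji _].
by rewrite subr_eq0 (inj_eq x_inj) (negbTE ji).
Qed.

(** The values of A_d at the nodes are multiples of sigma_d of X minus one node; the strict bound on
    Q pays for the removed node. *)
Lemma sylvA_eq0 X d P Q : P != 0 -> interpolates X P Q ->
  (size P <= d)%N -> (size Q < #|X| - d)%N -> sylvA X d = 0.
Proof.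
move=> P0 PQ sP sQ; apply: (@poly_eq0_nodes X) => [|i iX].
  by rewrite (leq_trans (size_sylvA _ _)) //; lia.
rewrite sylvA_node // (@sylv_coef_eq0 _ _ P Q) ?mulr0 //.
  exact: interpolates_sub (subsetDl _ _) PQ.
by move: sQ; rewrite (cardsD1 i X) iX; lia.
Qed.

(** Induction on |X|: if sigma_(k+1)(X) = 0, the pair (A_k, B_k) of X minus x_i also interpolates at
    x_i. It serves as witness unless it is zero. *)
Lemma interpolates_sylv_coef_eq0 X k : sylv_coef X k = 0 ->
  exists P Q, [/\ (P != 0) || (Q != 0), interpolates X P Q,
    (size P <= k)%N & (size Q <= #|X| - k)%N].
Proof.
elim: {X}_.+1 {-2}X (ltnSn #|X|) k => // n IHn X ltXn k.
have in_poly (X' : {set I}) i : i \in X' ->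
    (\prod_(j in X') ('X - (x j)%:P)).[x i] = 0.
  by move=> iX; rewrite horner_prod (bigD1 i) //= hornerXsubC subrr mul0r.
case: k => [|k] c0.
  (* Only the empty subset counts, so sigma_0(X) is the product of the y_i. Where y_i = 0, Q is
     free, and it can vanish at all other nodes. *)
  have /prodf_eq0[i iX yi0] : \prod_(i in X) y i == 0.
    move: c0; rewrite /sylv_coef (big_pred1 set0) => [|S]; last first.
      rewrite cards_eq0; apply: andb_idl => /eqP ->; exact: sub0set.
    rewrite /sylv_weight setD0 [X in _ / X]big1 ?divr1 => [->//|j _].
    by rewrite big_set0.
  exists 0, (\prod_(j in X :\ i) ('X - (x j)%:P)); split.
  - by apply/orP; right; rewrite -size_poly_gt0 size_prod_XsubC_set.
  - move=> j jX; rewrite horner0; have [->|ji] := eqVneq j i.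
      by rewrite (eqP yi0) mul0r.
    by rewrite in_poly ?mulr0 // !inE ji.
  - by rewrite size_poly0.
  - by rewrite size_prod_XsubC_set (cardsD1 i X) iX subn0.
have [X0|[i iX]] := set_0Vmem X.
  exists 1, 0; split; rewrite ?oner_eq0 ?size_poly1 ?size_poly0 //.
  by move=> i; rewrite X0 inE.
have cX : #|X| = #|X :\ i|.+1 by rewrite (cardsD1 i X) iX.
have interpX P Q : interpolates (X :\ i) P Q -> P.[x i] = y i * Q.[x i] ->
    interpolates X P Q.
  move=> PQ PQi j jX; have [->//|ji] := eqVneq j i.
  by apply: PQ; rewrite !inE ji.
have [nz|] := boolP ((sylvA (X :\ i) k != 0) || (sylvB (X :\ i) k != 0)).
  exists (sylvA (X :\ i) k), (sylvB (X :\ i) k); split=> //.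
  - apply: interpX; first exact: sylv_interpolates.
    apply/eqP; rewrite -subr_eq0; have /esym/eqP := sylv_coef_recl k iX.
    by rewrite c0 mul0r mulf_eq0 signr_eq0.
  - exact: size_sylvA.
  - by rewrite (leq_trans (size_sylvB _ _)) // cX subSS.
(* The pairs for k and k.+1 on X :\ i span a plane, in which interpolation at
   the missing node is one linear condition, unless they are proportional; then
   the degrees leave room for the factor 'X - x i. *)
rewrite negb_or !negbK => /andP[/eqP A0 /eqP B0].
have ltXi : (#|X :\ i| < n)%N by rewrite -ltnS -cX.
(* The zero pair has zero top coefficients: B_k gives sigma_(k+1) = 0, and A_k gives sigma_k = 0 for
   the next pair. *)
have [|P1 [Q1 [nz1 PQ1 sP1 sQ1]]] := IHn _ ltXi k.+1.
  apply/eqP; have /eqP := coef_sylvB (X :\ i) k.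
  by rewrite B0 coef0 eq_sym mulf_eq0 signr_eq0.
have [|P2 [Q2 [nz2 PQ2 sP2 sQ2]]] := IHn _ ltXi k.
  by rewrite -coef_sylvA A0 coef0.
pose c1 := P1.[x i] - y i * Q1.[x i]; pose c2 := P2.[x i] - y i * Q2.[x i].
have [c10|c1n0] := eqVneq c1 0.
  exists P1, Q1; split=> //.
  - by apply: interpX => //; apply/eqP; rewrite -subr_eq0 -/c1 c10.
  - by rewrite (leq_trans sQ1) // cX; lia.
have [c20|c2n0] := eqVneq c2 0.
  exists P2, Q2; split=> //.
  - by apply: interpX => //; apply/eqP; rewrite -subr_eq0 -/c2 c20.
  - by rewrite (leq_trans sP2).
  - by rewrite (leq_trans sQ2) // cX; lia.
(* The coefficients make the defect at x_i equal to c2 c1 - c1 c2 = 0. *)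
have [nz|] := boolP ((c2 *: P1 - c1 *: P2 != 0) || (c2 *: Q1 - c1 *: Q2 != 0)).
  have size_comb P P' c c' m : (size P <= m)%N -> (size P' <= m)%N ->
      (size (c *: P - c' *: P')%R <= m)%N.
    move=> sP sP'; rewrite (leq_trans (size_polyD _ _)) // size_polyN geq_max.
    by rewrite !(leq_trans (size_scale_leq _ _)).
  exists (c2 *: P1 - c1 *: P2), (c2 *: Q1 - c1 *: Q2); split=> //.
  - apply: interpX => [j jX|]; last by rewrite !hornerE /c1 /c2; ring.
    by rewrite !hornerE PQ1 // PQ2 //; ring.
  - by apply: size_comb; lia.
  - by apply: size_comb; lia.
rewrite negb_or !negbK !subr_eq0 => /andP[/eqP P12 /eqP Q12].
have sP1k : (size P1 <= k)%N.
  by rewrite -(size_scale P1 c2n0) P12 size_scale.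
have XC0 : 'X - (x i)%:P != 0 by rewrite polyXsubC_eq0.
exists (P1 * ('X - (x i)%:P)), (Q1 * ('X - (x i)%:P)); split.
- by rewrite !mulf_eq0 (negbTE XC0) !orbF.
- apply: interpX => [j jX|]; last by rewrite !hornerM hornerXsubC subrr !mulr0.
  by rewrite !hornerM PQ1 //; ring.
- by have := size_polyMleq P1 ('X - (x i)%:P); rewrite size_XsubC; lia.
- have [->|Q10] := eqVneq Q1 0; first by rewrite mul0r size_poly0.
  rewrite size_Mmonic ?monicXsubC // size_XsubC.
  by move: Q10; rewrite -size_poly_gt0; lia.
Qed.

(* If deg B_d = |X| - e for some d < e <= a, a pair (P, Q) given by
   sigma_e(X) = 0 is proportional to (A_d, B_d), so that deg P < d and
   sylvA_eq0 contradicts A_d <> 0. *)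
Lemma size_sylvB_max X a d : (d <= a)%N -> (a < #|X|)%N -> sylvA X d != 0 ->
  (forall e, (d < e <= a)%N -> sylvA X e = 0) ->
  (size (sylvB X d) <= #|X| - a)%N.
Proof.
move=> da aX A0 Amax; rewrite -(subnKC da) in aX Amax *.
elim: (a - d)%N => [|m IHm] in aX Amax *; first by rewrite addn0 size_sylvB.
have {IHm} sB : (size (sylvB X d) <= #|X| - (d + m))%N.
  by apply: IHm => [|e em]; [lia | apply: Amax; lia].
have [|P [Q [nz PQ sP sQ]]] := @interpolates_sylv_coef_eq0 X (d + m).+1.
  by rewrite -coef_sylvA -addnS Amax ?coef0 //; lia.
rewrite leqNgt; apply/negP => sB'.
have sB1 : size (sylvB X d) = (#|X| - (d + m))%N by lia.
have Bn0 : sylvB X d != 0 by rewrite -size_poly_gt0; lia.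
have sA := size_sylvA X d.
have cross : P * sylvB X d = sylvA X d * Q.
  have := size_polyMleq P (sylvB X d); have := size_polyMleq (sylvA X d) Q.
  move=> s1 s2; apply: (@interpolates_cross X) => //.
  - exact: sylv_interpolates.
  - by lia.
  - by lia.
have Qn0 : Q != 0.
  apply: contraTneq nz => Q0; move/eqP: cross.
  by rewrite Q0 mulr0 mulf_eq0 (negbTE Bn0) orbF negb_or !negbK eqxx andbT.
have Pn0 : P != 0.
  apply/eqP => P0; move/esym/eqP: cross.
  by rewrite P0 mul0r mulf_eq0 (negbTE A0) (negbTE Qn0).
(* Since Q has smaller size than B_d, P has smaller size than A_d, hence at most d. *)
have sPB : (size P + size (sylvB X d)).-1 = (size (sylvA X d) + size Q).-1.
  by rewrite -!size_mul // cross.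
move/eqP: A0; apply; apply: (@sylvA_eq0 _ _ P Q) => //.
- by move: Pn0 Qn0; rewrite -!size_poly_gt0; lia.
- by lia.
Qed.

(** A zero of B_d at x_i is also one of A_d. Dividing both by 'X - x_i leaves a pair that still
    interpolates on X, at x_i by proportionality to (A, B), and whose degrees are too small for A_d
    to be nonzero. *)
Lemma sylvB_node_neq0 X d i A B : (d < #|X|)%N -> sylvA X d != 0 -> i \in X ->
  sylvA X d * B = A * sylvB X d -> B.[x i] != 0 -> A.[x i] = y i * B.[x i] ->
  (sylvB X d).[x i] != 0.
Proof.
move=> dX A0 iX cross Bi ABi; apply/negP => /eqP Bdi.
have Adi : (sylvA X d).[x i] = 0 by rewrite sylv_interpolates // Bdi mulr0.
have /factor_theorem[P defA] : root (sylvA X d) (x i) by apply/eqP.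
have /factor_theorem[Q defB] : root (sylvB X d) (x i) by apply/eqP.
have XC0 : 'X - (x i)%:P != 0 by rewrite polyXsubC_eq0.
have Pn0 : P != 0 by apply: contraNneq A0 => P0; rewrite defA P0 mul0r.
have crossPQ : P * B = A * Q.
  by apply: (mulIf XC0); rewrite -mulrA (mulrC B) mulrA -defA cross defB mulrA.
have PQ : interpolates X P Q.
  move=> j jX; have [->|ji] := eqVneq j i.
    by apply: (mulIf Bi); rewrite -hornerM crossPQ hornerM ABi; ring.
  have xji : x j - x i != 0 by rewrite subr_eq0 (inj_eq x_inj).
  apply: (mulIf xji); rewrite -mulrA -(hornerXsubC (x i)) -!hornerM -defA -defB.
  exact: sylv_interpolates.
have := size_sylvA X d; have := size_sylvB X d.
rewrite defA size_Mmonic ?monicXsubC // size_XsubC addn2 /= => sB sP.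
move/eqP: A0; apply; apply: (@sylvA_eq0 _ _ P Q) => //.
(* For Q = 0 the strict size bound comes from d < |X|. *)
have [->|Qn0] := eqVneq Q 0; first by rewrite size_poly0; lia.
by move: sB; rewrite defB size_Mmonic ?monicXsubC // size_XsubC addn2.
Qed.

End SylvesterSums.

(** * From finite sets of points to sets of indices *)

Section Nodes.

Variables (K : fieldType) (l : nat) (x y : 'I_l.+1 -> K).
Hypothesis x_inj : injective x.

Local Open Scope fset_scope.

Lemma nodesE : nodes x = [fset x i | i in [set: 'I_l.+1]].
Proof.
apply/fsetP => z.
by apply/imfsetP/imfsetP => -[i _ ->]; exists i; rewrite /= ?inE.
Qed.

Lemma mem_imfset_set (S : {set 'I_l.+1}) i :
  (x i \in [fset x j | j in S]) = (i \in S).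
Proof. by rewrite mem_imfset. Qed.

Lemma card_imfset_set (S : {set 'I_l.+1}) : #|` [fset x j | j in S]| = #|S|.
Proof. by rewrite card_imfset //= -cardE. Qed.

Lemma big_imfset_set (R : Type) (idx : R) (op : Monoid.com_law idx)
    (S : {set 'I_l.+1}) (F : K -> R) :
  \big[op/idx]_(z <- [fset x j | j in S]) F z = \big[op/idx]_(j in S) F (x j).
Proof. by rewrite big_imfset /= ?big_enum // => i j _ _ /x_inj. Qed.

Lemma nodesD (S : {set 'I_l.+1}) :
  nodes x `\` [fset x j | j in S] = [fset x j | j in [set: 'I_l.+1] :\: S].
Proof.
apply/fsetP => z; rewrite nodesE inE; apply/andP/imfsetP => /=.
  case=> zS /imfsetP[i _ zi]; exists i => //; rewrite !inE andbT.
  by rewrite -mem_imfset_set -zi.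
by case=> i; rewrite !inE andbT => iS ->; rewrite !mem_imfset_set inE.
Qed.

(** Injectivity of x makes S -> x(S) a size-preserving bijection onto the subsets of the nodes. *)
Lemma sum_fpowerset_nodes (V : nmodType) (p : pred nat) (F : {fset K} -> V) :
  \sum_(X <- fpowerset (nodes x) | p #|` X|) F X =
  \sum_(S : {set 'I_l.+1} | p #|S|) F [fset x j | j in S].
Proof.
have perm : perm_eq (fpowerset (nodes x))
    [seq [fset x j | j in T] | T : {set 'I_l.+1}].
  apply: uniq_perm => [||X]; first exact: fset_uniq.
    rewrite map_inj_uniq ?enum_uniq // => S T /fsetP ST.
    by apply/setP => i; rewrite -!mem_imfset_set ST.
  rewrite fpowersetE; apply/fsubsetP/imageP => [XN|[T _ ->] z].
    exists [set i | x i \in X] => //; apply/fsetP => z; apply/idP/imfsetP => /=.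
      move=> zX; have /imfsetP[i _ zi] := XN z zX.
      by exists i => //; rewrite inE -zi.
    by case=> i; rewrite inE => ? ->.
  by case/imfsetP => i _ ->; rewrite nodesE mem_imfset_set inE.
rewrite (perm_big _ perm) big_image_cond /=; apply: eq_bigl => S.
by rewrite card_imfset_set.
Qed.

Lemma diffprod_imfset (S T : {set 'I_l.+1}) :
  diffprod [fset x j | j in S] [fset x j | j in T] =
  \prod_(i in S) \prod_(j in T) (x i - x j).
Proof.
rewrite /diffprod big_imfset_set; apply: eq_bigr => i _.
by rewrite big_imfset_set.
Qed.

Lemma sylvesterAE d : sylvesterA x y d = sylvA x y setT d.
Proof.
rewrite /sylvesterA (sum_fpowerset_nodes (pred1 d)).
apply: eq_big => [S|S _]; first by rewrite subsetT.
rewrite nodesD diffprod_imfset /diffprodXl big_imfset_set /sylv_weight.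
congr (_ / _ *: _); apply: eq_bigl => j.
by rewrite mem_imfset_set !inE andbT.
Qed.

(** Reindexing by complements: as d <= l, the complement of a set of l - d nodes has d + 1
    elements. *)
Lemma sylvesterBE d : (d <= l)%N -> sylvesterB x y d = sylvB x y setT d.
Proof.
move=> dl; rewrite /sylvesterB (sum_fpowerset_nodes (pred1 (l - d)%N)).
rewrite (reindex_inj (@setC_inj _)).
have arith c : (l.+1 == c + (l - d))%N = (c == d.+1) by apply/eqP/eqP; lia.
apply: eq_big => [S|S _].
  rewrite subsetT /= -(eqn_add2l #|S|) cardsC card_ord; exact: arith.
rewrite nodesD diffprod_imfset /diffprodXr big_imfset_set /sylv_weight.
rewrite !setTD setCK; congr (_ / _ *: _); apply: eq_bigl => j.
by rewrite mem_imfset_set.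
Qed.

End Nodes.

(** * Solvability of the interpolation problem and uniqueness of the quotient *)

Theorem theorem3p1 (K : fieldType) (a b : nat)
    (x y : 'I_(a + b).+1 -> K) (x_inj : injective x)
    (d : nat) (d_le_a : (d <= a)%N)
    (A0_neq0 : sylvesterA x y d != 0)
    (d_max : forall e : nat, (d < e <= a)%N -> sylvesterA x y e = 0) :
  let A0 := sylvesterA x y d in
  let B0 := sylvesterB x y d in
  [/\ (size B0 <= b.+1)%N,
      (exists A B : {poly K}, cauchy_solution a b x y A B) <->
        (forall i, B0.[x i] != 0)
    & (forall i, B0.[x i] != 0) ->
        cauchy_solution a b x y A0 B0 /\
        forall A B : {poly K}, cauchy_solution a b x y A B ->
          tofrac A / tofrac B = tofrac A0 / tofrac B0].
Proof.
move=> A0 B0.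
have A0E : A0 = sylvA x y setT d by exact: sylvesterAE.
have B0E : B0 = sylvB x y setT d by apply: sylvesterBE => //; lia.
have cT : #|[set: 'I_(a + b).+1]| = (a + b).+1 by rewrite cardsT card_ord.
have A0n0 : sylvA x y setT d != 0 by rewrite -A0E.
have sB : (size B0 <= b.+1)%N.
  have -> : b.+1 = (#|[set: 'I_(a + b).+1]| - a)%N by rewrite cT; lia.
  rewrite B0E.
  apply: size_sylvB_max => // [|e ed]; first by rewrite cT; lia.
  by rewrite -sylvesterAE // d_max.
have sA : (size A0 <= a.+1)%N.
  by rewrite A0E (leq_trans (size_sylvA _ _ _ _)).
have interp0 i : A0.[x i] = y i * B0.[x i].
  by rewrite A0E B0E; apply: sylv_interpolates; rewrite ?inE.
have interp A B i : cauchy_solution a b x y A B -> A.[x i] = y i * B.[x i].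
  by case=> _ _ nz e; rewrite -e divfK.
(* Both products have degree at most a + b, one less than the number of nodes. *)
have cross A B : cauchy_solution a b x y A B -> A0 * B = A * B0.
  move=> sol; have [sA' sB' _ _] := sol.
  have := size_polyMleq A0 B; have := size_polyMleq A B0 => s1 s2.
  apply: (@interpolates_cross _ _ _ y x_inj setT) => [i _|i _||].
  - exact: interp0.
  - exact: interp.
  - by rewrite cT; lia.
  - by rewrite cT; lia.
have sol0 : (forall i, B0.[x i] != 0) -> cauchy_solution a b x y A0 B0.
  by move=> nz; split=> // i; rewrite interp0 mulfK.
split=> //.
  split=> [[A [B sol]] i|/sol0 sol]; last by exists A0, B0.
  rewrite B0E; apply: (@sylvB_node_neq0 _ _ _ y x_inj setT d i A B) => //.
  - by rewrite cT; lia.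
  - by rewrite -A0E -B0E (cross A B).
  - by case: sol.
  - exact: interp.
move=> nz; split=> [|A B sol]; first exact: sol0.
(* A nonzero value at one node makes a denominator nonzero as a polynomial, so that
   cross-multiplication decides equality of the quotients. *)
have neq0 (p : {poly K}) : p.[x ord0] != 0 -> tofrac p != 0.
  by rewrite tofrac_eq0; apply: contraNneq => ->; rewrite horner0.
have Bn0 : tofrac B != 0 by apply: neq0; case: sol.
have B0n0 : tofrac B0 != 0 by apply: neq0; apply: nz.
apply/eqP; rewrite (eqr_div _ _ Bn0 B0n0).
have := congr1 (@tofrac _) (cross A B sol).
by rewrite !tofracM => ->.
Qed.
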